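(* Let $\mathbb{E}[\ell]=\frac{1}{2^\ell}\sum_{\mathbf{b}\in B_\ell} r(\mathbf{b})$ be the expected length of the right lane of a uniformly random arrival sequence of length $\ell$. Then $$\lim_{\ell\to\infty}\frac{\mathbb{E}[\ell]}{\ell}=\frac12 .$$
   Context: An arrival sequence of length $\ell$ is a binary string $\mathbf{b}=b_1b_2\cdots b_\ell\in\{0,1\}^\ell$; $B_\ell$ is the set of all of them. Cars $1,2,\dots,\ell$ arrive in order and choose between two initially empty lanes (left and right): if $b_i=0$, car $i$ enters the right lane; if $b_i=1$, car $i$ enters the currently shorter lane, and enters the right lane if both lanes have the same length. $r(\mathbf{b})$ denotes the final number of cars in the right lane. *)

(* Defs.v *)
From mathcomp Require Import all_boot all_order all_algebra.
From mathcomp Require Import all_classical all_reals all_analysis.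
Set Implicit Arguments.
Unset Strict Implicit.
Unset Printing Implicit Defensive.
Import Order.TTheory GRing.Theory Num.Theory.
Import numFieldNormedType.Exports.

(* A state is the pair (length of left lane, length of right lane); the bit
   b_i = 1 is [true].  A car with bit 1 joins the strictly shorter lane, and
   the right lane in case of a tie. *)
Definition arrive (s : nat * nat) (b : bool) : nat * nat :=
  if b && (s.1 < s.2)%N then (s.1.+1, s.2) else (s.1, s.2.+1).

Definition final_lanes (b : seq bool) : nat * nat := foldl arrive (0%N, 0%N) b.

Definition right_lane (b : seq bool) : nat := (final_lanes b).2.

(* B_l is the finite type [l.-tuple bool], of cardinality 2 ^ l. *)
Definition expected_right_lane (R : realType) (l : nat) : R :=
  (1 / 2 ^+ l * \sum_(b : l.-tuple bool) (right_lane b)%:R)%R.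

(* Main.v *)
(* The surplus of the right lane over the left one is a simple random walk
   reflected at 0, so its second moment after l cars is exactly l; hence its
   mean is at most sqrt l, while r(b) = (l + surplus) / 2. *)
Require Import Defs.
From mathcomp Require Import all_boot all_order all_algebra.
From mathcomp Require Import all_classical all_reals all_analysis.
From mathcomp Require Import ring lra zify.
Import Order.TTheory GRing.Theory Num.Theory.
Import numFieldNormedType.Exports.
Local Open Scope classical_set_scope.
Local Open Scope ring_scope.

Definition surplus (s : nat * nat) : nat := (s.2 - s.1)%N.

Lemma foldl_arrive_leq (b : seq bool) (s : nat * nat) :
  (s.1 <= s.2)%N -> ((foldl arrive s b).1 <= (foldl arrive s b).2)%N.
Proof.
elim: b s => [|x b IHb] [m n] //= le_mn; apply: IHb; rewrite /arrive /=.
by case: ifP => /= [/andP[]|_] //; apply: leqW.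
Qed.

Lemma foldl_arrive_total (b : seq bool) (s : nat * nat) :
  ((foldl arrive s b).1 + (foldl arrive s b).2 = s.1 + s.2 + size b)%N.
Proof.
elim: b s => [|x b IHb] [m n] /=; first by rewrite addn0.
by rewrite IHb /arrive /=; case: ifP => _ /=; lia.
Qed.

(** The lanes sum to [size b] and differ by the surplus. The truncated subtraction in [surplus] is a
    true difference because the right lane is never the shorter one. *)
Lemma right_lane_double (b : seq bool) :
  ((right_lane b).*2 = size b + surplus (final_lanes b))%N.
Proof.
have := foldl_arrive_leq b (0, 0)%N (leqnn 0).
have := foldl_arrive_total b (0, 0)%N.
by rewrite /right_lane /surplus /final_lanes /=; lia.
Qed.

(** Conditions on the first car, the one that [foldl] consumes first. *)
Lemma sum_tupleS (F : seq bool -> nat) (l : nat) :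
  (\sum_(b : l.+1.-tuple bool) F b =
   \sum_(b : l.-tuple bool) (F (true :: b) + F (false :: b)))%N.
Proof.
rewrite (reindex (fun p : bool * l.-tuple bool => [tuple of p.1 :: p.2])) /=.
  rewrite -(pair_bigA _ (fun x (b : l.-tuple bool) => F (x :: b))) /=.
  by rewrite big_bool /= big_split.
exists (fun b => (thead b, [tuple of behead b])) => [[x b]|b] _ /=.
  by rewrite theadE; congr (_, _); apply: val_inj.
by rewrite [RHS]tuple_eta.
Qed.

(** Induction on [l] for an arbitrary start [s], since the first car changes the start. From surplus
    d > 0 the two bits lead to d - 1 and d + 1, and (d - 1)^2 + (d + 1)^2 = 2(d^2 + 1); from d = 0
    both lead to 1, and 1 + 1 = 2(0 + 1). *)
Lemma sum_surplus_sqr (l : nat) (s : nat * nat) : (s.1 <= s.2)%N ->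
  (\sum_(b : l.-tuple bool) surplus (foldl arrive s b) ^ 2 =
   2 ^ l * (surplus s ^ 2 + l))%N.
Proof.
elim: l s => [|l IHl] [m n] le_mn.
  rewrite (eq_bigr (fun=> surplus (m, n) ^ 2)%N) => [|b _]; last by rewrite tuple0.
  by rewrite sum_nat_const card_tuple expn0 addn0.
rewrite (sum_tupleS (fun b => surplus (foldl arrive (m, n) b) ^ 2)%N).
rewrite big_split /= !IHl.
- move: le_mn; rewrite /arrive /surplus /= => le_mn.
  rewrite -mulnDr (expnSr 2) -mulnA; congr (_ * _)%N.
  case: ltngtP le_mn => //= [lt_mn _|-> _]; last by rewrite subSnn subnn; lia.
  (* Writing [n] as [(n - m.+1) + m.+1] makes every truncated subtraction exact. *)
  by rewrite -(subnK lt_mn); nia.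
- by rewrite /=; apply: leqW.
- by rewrite /arrive /=; case: ifP => /= [|_] //; apply: leqW.
Qed.

Definition mean_surplus (R : realType) (l : nat) : R :=
  (\sum_(b : l.-tuple bool) (surplus (final_lanes b))%:R) / 2 ^+ l.

Lemma expected_right_laneE (R : realType) (l : nat) :
  expected_right_lane R l = (l%:R + mean_surplus R l) / 2.
Proof.
have e2 : (2 ^+ l : R) != 0 by rewrite expf_neq0.
(* The sum of doubled lengths is computed in two ways: the right side splits into size plus surplus,
   the left side yields a factor 2. *)
have := erefl (\sum_(b : l.-tuple bool) (right_lane b).*2%:R : R).
rewrite [in RHS](eq_bigr (fun b : l.-tuple bool =>
  l%:R + (surplus (final_lanes b))%:R)) => [|b _]; last first.
  by rewrite right_lane_double size_tuple natrD.
rewrite big_split /= sumr_const card_tuple card_bool -(mulr_natr l%:R) natrX.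
rewrite (eq_bigr (fun b : l.-tuple bool => 2 * (right_lane b)%:R)) => [|b _];
  last by rewrite -mul2n natrM.
rewrite -mulr_sumr /expected_right_lane /mean_surplus => E.
apply: (mulfI (x := 2)) => //; rewrite mulrCA E.
by field.
Qed.

Lemma mean_surplus_ge0 (R : realType) (l : nat) : 0 <= mean_surplus R l.
Proof. by rewrite divr_ge0 ?exprn_ge0 ?sumr_ge0. Qed.

Lemma mean_surplus_le_sqrt (R : realType) (l : nat) : mean_surplus R l <= Num.sqrt l%:R.
Proof.
set t := Num.sqrt _.
have t2 : t ^+ 2 = l%:R by rewrite sqr_sqrtr.
(* For [l = 0] also [t = 0], and the factor [2 * t] used below could not be cancelled. *)
have [l0|l0] := posnP l.
  rewrite /mean_surplus l0 big1 ?mul0r ?sqrtr_ge0 // => b _.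
  by rewrite tuple0.
have t0 : 0 < t by rewrite sqrtr_gt0 ltr0n.
have e2 : 0 < (2 ^+ l : R) by rewrite exprn_gt0.
have S2 : \sum_(b : l.-tuple bool) (surplus (final_lanes b))%:R ^+ 2
          = 2 ^+ l * l%:R :> R.
  rewrite (eq_bigr (fun b : l.-tuple bool =>
    (surplus (final_lanes b) ^ 2)%N%:R)) => [|b _]; last by rewrite natrX.
  by rewrite -natr_sum sum_surplus_sqr // natrM natrX.
rewrite /mean_surplus ler_pdivrMr // -(ler_pM2l (x := 2 * t)) ?mulr_gt0 //.
rewrite mulr_sumr.
(* AM-GM: [2 t d <= d^2 + t^2] *)
apply: (@le_trans _ _ (\sum_(b : l.-tuple bool)
    ((surplus (final_lanes b))%:R ^+ 2 + t ^+ 2))).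
  apply: ler_sum => b _; move: (surplus _)%:R => d.
  by have := sqr_ge0 (d - t); rewrite sqrrB; lra.
(* With [t ^+ 2 = l%:R] both halves of the sum equal [2 ^+ l * t ^+ 2], so the two sides agree. *)
rewrite big_split /= S2 sumr_const card_tuple card_bool -(mulr_natr (t ^+ 2)) natrX.
by rewrite -t2 le_eqVlt; apply/orP; left; apply/eqP; ring.
Qed.

Theorem corollary2p4 (R : realType) :
  (fun l : nat => expected_right_lane R l / l%:R) @ \oo --> (1 / 2 : R).
Proof.
(* Shifting the index keeps the denominator [n.+1] nonzero and makes its inverse [harmonic n]. *)
rewrite -cvg_shiftS.
apply: (@squeeze_cvgr _ _ _ _ (fun=> 1 / 2)
  (fun n => 1 / 2 + Num.sqrt (harmonic n) / 2)).
- apply: nearW => n; rewrite /= expected_right_laneE /harmonic /=.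
  have n0 : 0 < n.+1%:R :> R by rewrite ltr0n.
  set a : R := n.+1%:R in n0 *.
  (* This turns [Num.sqrt a^-1] into [Num.sqrt a / a], so the upper bound is [m <= Num.sqrt a]
     divided by [2 * a]. *)
  have a2 : Num.sqrt a^-1 * a = Num.sqrt a.
    rewrite -{2}(sqr_sqrtr (ltW n0)) sqrtrV ?ltW //.
    by rewrite expr2 mulKf // gt_eqF // sqrtr_gt0.
  have := mean_surplus_ge0 R n.+1; have := mean_surplus_le_sqrt R n.+1.
  rewrite -/a; move: (mean_surplus R n.+1) => m h1 h2.
  have -> : Num.sqrt a^-1 = Num.sqrt a / a by rewrite -a2 mulfK ?gt_eqF.
  have -> : (a + m) / 2 / a = 1 / 2 + m / 2 / a by field; rewrite gt_eqF.
  rewrite lerDl lerD2l mulrAC [leRHS]mulrAC !ler_pM2r ?invr_gt0 // h1 andbT.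
  by rewrite !divr_ge0 // ltW.
- exact: cvg_cst.
(* The limit is put in the form [1 / 2 + Num.sqrt 0 * 2^-1], so that continuity of the square root
   at 0 applies. *)
- rewrite -[X in _ --> X]addr0 -[X in _ + X](mul0r 2^-1) -[X in _ + X * _](sqrtr0 R).
  apply: cvgD; first exact: cvg_cst.
  apply: cvgMr_tmp; apply: continuous_cvg; last exact: cvg_harmonic.
  exact: sqrt_continuous.
Qed.
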